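(* Let $p\in(0,1)$ and let $(\mathcal N,d,0)$ be a pointed $p$-metric space with $\mathcal N=\{0,x,y\}$ (three distinct points). The following are equivalent: (a) one of the $p$-triangle inequalities among the distances between $0,x,y$ is an equality, i.e. one of $d^p(x,0)+d^p(y,0)=d^p(x,y)$, $d^p(x,0)+d^p(x,y)=d^p(y,0)$, $d^p(y,0)+d^p(x,y)=d^p(x,0)$ holds; (b) $\mathrm{aa}_p(\mathcal N)=1$. Moreover, if (b) does not hold, then $\mathrm{aa}_p(\mathcal N)=\mathrm{amen}_p(\mathcal N,\mathcal M')$, where $\mathcal M'=\mathcal N\cup\{z\}$ with $z\notin\mathcal N$, equipped with the $p$-metric $d'$ which agrees with $d$ on $\mathcal N\times\mathcal N$ and satisfies, for every bijection $u:\{1,2,3\}\to\mathcal N$, \[d'(u(1),z)=\Big(\frac{d^p(u(2),u(1))+d^p(u(3),u(1))-d^p(u(2),u(3))}{2}\Big)^{1/p}.\]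
   Context: A $p$-metric space is a set with $d$ such that $d^p$ is a metric; pointed means a distinguished point $0$. A $p$-Banach space is a complete vector space with a $p$-norm (norm axioms with $\|x+y\|^p\le\|x\|^p+\|y\|^p$). For a pointed $p$-metric space $\mathcal M$, $\delta(x)$ is evaluation at $x$ on real functions vanishing at $0$, and $\mathcal F_p(\mathcal M)$ is the completion of $\mathrm{span}\{\delta(x)\}$ under $\|\sum a_i\delta(x_i)\|=\sup\|\sum a_if(x_i)\|_Y$ over all $p$-Banach $Y$ and $1$-Lipschitz $f:\mathcal M\to Y$ with $f(0)=0$. For $0\in\mathcal N\subset\mathcal M$, $L_j:\mathcal F_p(\mathcal N)\to\mathcal F_p(\mathcal M)$ is the linear map with $\delta_{\mathcal N}(x)\mapsto\delta_{\mathcal M}(x)$; $\mathrm{amen}_p(\mathcal N,\mathcal M)=\|L_j^{-1}\|$ if $L_j$ is an isomorphism onto its range (the least constant $C$ with which $\mathcal N$ is $p$-amenable in $\mathcal M$), and $+\infty$ otherwise. $\mathrm{aa}_p(\mathcal N)=\sup\{\mathrm{amen}_p(\mathcal N,\mathcal M'):\mathcal M'\text{ a }p\text{-metric space containing }\mathcal N\text{ as a subspace}\}$. *)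

(* Defs.v *)
From HB Require Import structures.
From mathcomp Require Import all_boot all_order all_algebra.
From mathcomp Require Import all_classical all_reals all_analysis.
From mathcomp Require Import Rstruct.
Set Implicit Arguments. Unset Strict Implicit. Unset Printing Implicit Defensive.
Import Order.TTheory GRing.Theory Num.Theory.
Local Open Scope ring_scope.
Local Open Scope classical_set_scope.

Definition RR : realType := Rdefinitions.R.

Definition is_pmetric (p : RR) (T : Type) (d : T -> T -> RR) : Prop :=
  [/\ (forall a b, 0 <= d a b),
      (forall a b, d a b `^ p = 0 <-> a = b),
      (forall a b, d a b `^ p = d b a `^ p) &
      (forall a b c, d a c `^ p <= d a b `^ p + d b c `^ p)].

Definition is_pnorm (p : RR) (V : lmodType RR) (nrm : V -> RR) : Prop :=
  [/\ (forall v, 0 <= nrm v),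
      (forall v, nrm v = 0 -> v = 0),
      (forall (a : RR) v, nrm (a *: v) = `|a| * nrm v) &
      (forall u v, nrm (u + v) `^ p <= nrm u `^ p + nrm v `^ p)].

(* completeness w.r.t. the metric (u,v) |-> nrm (u - v) ^ p
   (equivalently w.r.t. nrm (u - v)) *)
Definition pnorm_complete (V : lmodType RR) (nrm : V -> RR) : Prop :=
  forall u : nat -> V,
    (forall e : RR, 0 < e -> exists N : nat, forall n m : nat,
        (N <= n)%N -> (N <= m)%N -> nrm (u n - u m) < e) ->
    exists l : V, forall e : RR, 0 < e -> exists N : nat, forall n : nat,
        (N <= n)%N -> nrm (u n - l) < e.

Record pBanach (p : RR) := PBanach {
  pb_carrier : lmodType RR;
  pb_norm : pb_carrier -> RR;
  pb_pnorm : is_pnorm p pb_norm;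
  pb_complete : pnorm_complete pb_norm }.

Definition lip1_pointed (T : Type) (d : T -> T -> RR) (t0 : T)
  (V : lmodType RR) (nrm : V -> RR) (f : T -> V) : Prop :=
  f t0 = 0 /\ forall a b, nrm (f a - f b) <= d a b.

(* Norm of the element  sum_i a_i delta(x_i)  of span{delta(x)} inside
   F_p(T), the element being given by the list mu = [(a_i, x_i)]. *)
Definition Fp_norm (p : RR) (T : Type) (d : T -> T -> RR) (t0 : T)
  (mu : seq (RR * T)) : \bar RR :=
  ereal_sup [set e : \bar RR | exists (Y : pBanach p)
      (f : T -> pb_carrier Y),
      lip1_pointed d t0 (@pb_norm p Y) f /\
      e = (pb_norm (\sum_(q <- mu) q.1 *: f q.2))%:E].

(* amen_p(N, M) for N embedded in M via the (isometric, pointed) map j: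
   the least C such that ||mu||_{F_p(N)} <= C ||L_j mu||_{F_p(M)} for all
   mu in span{delta(x)} (dense in F_p(N)), i.e. ||L_j^{-1}||; it is +oo
   when no such C exists (L_j not an isomorphism onto its range). *)
Definition amen_p (p : RR) (N : Type) (dN : N -> N -> RR) (n0 : N)
  (M : Type) (dM : M -> M -> RR) (m0 : M) (j : N -> M) : \bar RR :=
  ereal_inf [set e : \bar RR | exists C : RR, 0 <= C /\
      (forall mu : seq (RR * N),
         Fp_norm p dN n0 mu <=
         C%:E * Fp_norm p dM m0 [seq (q.1, j q.2) | q <- mu])%E /\
      e = C%:E].

Definition aa_p (p : RR) (N : Type) (dN : N -> N -> RR) (n0 : N) : \bar RR :=
  ereal_sup [set e : \bar RR | exists (M : Type) (dM : M -> M -> RR)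
      (j : N -> M),
      is_pmetric p dM /\ injective j /\
      (forall a b, dM (j a) (j b) = dN a b) /\
      e = amen_p p dN n0 dM (j n0) j].

(* Main.v *)
Require Import Defs.
From HB Require Import structures.
From mathcomp Require Import all_boot all_order all_algebra.
From mathcomp Require Import all_classical all_reals all_analysis.
From mathcomp Require Import Rstruct.
From mathcomp Require Import measurable_realfun.
From mathcomp Require Import generic_quotient ring_quotient.
From mathcomp Require Import ring lra.
Set Implicit Arguments. Unset Strict Implicit. Unset Printing Implicit Defensive.
Import Order.TTheory GRing.Theory Num.Theory.
Import numFieldNormedType.Exports.
Local Open Scope ring_scope.
Local Open Scope quotient_scope.
Local Open Scope classical_set_scope.

(* Put lo, lx, ly for the Gromov products, so that lo + lx = d(x,0)^p and so on;
   they are nonnegative, and one of them vanishes iff (a) holds.  For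
   mu = a delta(x) + b delta(y) let
     S(mu) = |a+b|^p lo + |a|^p lx + |b|^p ly,
   the cost of routing mu through a centre at p-distances lo, lx, ly from 0, x, y.

   In every M containing N one has |mu|^p >= S(mu): the metric space (M, d^p)
   retracts 1-Lipschitzly onto the tripod with legs lo, lx, ly (its coordinate on
   the leg of u is max(0, l_u - d(z,u)^p)), and the tripod embeds isometrically
   into L_p of its length measure, sending mu to a vector v with |v|^p = S(mu).  A point
   z realising the centre gives |mu|^p <= S(mu), so M' has the smallest norm among
   all M; if a leg vanishes, N itself contains the centre and the constant is 1.
   If no leg vanishes, the norm of N at delta(x) + delta(y) exceeds S: on R^2 take
   the p-norm given by the cheapest flow along the three edges of N.

   The test spaces are obtained as completions of p-seminormed spaces. *)

(** * The function t^p *)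

Section PowR.
Context {R : realType}.
Implicit Types (a b p s : R).

Lemma powR_ge_id p a : p <= 1 -> 0 <= a <= 1 -> a <= a `^ p.
Proof.
move=> p1 /andP[]; rewrite le_eqVlt => /predU1P[<- _|a0 a1].
  exact: powR_ge0.
by apply: ger1_powR; rewrite ?a0.
Qed.

Lemma powR_ge1 p a : 0 <= p -> 1 <= a -> 1 <= a `^ p.
Proof.
move=> p0 a1; have -> : 1 = 1 `^ p :> R by rewrite powR1.
by apply: ge0_ler_powR => //; rewrite nnegrE// (le_trans ler01).
Qed.

(** After division by a + b both terms lie in [0,1], where t <= t^p, and they add up to 1. *)
Lemma powRD_le p a b : 0 < p -> p <= 1 -> 0 <= a -> 0 <= b ->
  (a + b) `^ p <= a `^ p + b `^ p.
Proof.
move=> p0 p1 a0 b0.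
have := addr_ge0 a0 b0; rewrite le_eqVlt => /predU1P[<-|ab0].
  by rewrite powR0 ?gt_eqF// addr_ge0// powR_ge0.
have e c : 0 <= c -> c `^ p = (c / (a + b)) `^ p * (a + b) `^ p.
  move=> c0; have cab : 0 <= c / (a + b) by rewrite divr_ge0// ltW.
  by rewrite -(powRM _ cab (ltW ab0)) divfK ?gt_eqF.
rewrite (e a)// (e b)// -mulrDl.
rewrite -[leLHS]mul1r ler_wpM2r ?powR_ge0//.
have -> : 1 = a / (a + b) + b / (a + b) by rewrite -mulrDl divff ?gt_eqF.
rewrite lerD// powR_ge_id//.
- by rewrite divr_ge0 ?(ltW ab0)//= ler_pdivrMr// mul1r lerDl.
- by rewrite divr_ge0 ?(ltW ab0)//= ler_pdivrMr// mul1r lerDr.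
Qed.

Lemma ler_normD_powR p a b : 0 < p -> p <= 1 ->
  `|a + b| `^ p <= `|a| `^ p + `|b| `^ p.
Proof.
move=> p0 p1; apply: le_trans (@powRD_le p _ _ p0 p1 _ _) => //.
by rewrite ge0_ler_powR ?nnegrE ?ler_normD// ltW.
Qed.

Lemma powRK p a : 0 < p -> 0 <= a -> (a `^ p) `^ p^-1 = a.
Proof. by move=> p0 a0; rewrite -powRrM mulfV ?gt_eqF// powRr1. Qed.

Lemma powRVK p a : 0 < p -> 0 <= a -> (a `^ p^-1) `^ p = a.
Proof. by move=> p0 a0; rewrite -powRrM mulVf ?gt_eqF// powRr1. Qed.

Lemma ltr_powRV p a b : 0 < p -> 0 <= a -> 0 <= b ->
  (a `^ p^-1 < b) = (a < b `^ p).
Proof.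
move=> p0 a0 b0; apply/idP/idP => ab.
  rewrite -(@powRVK p a)//; apply: gt0_ltr_powR => //.
  by rewrite nnegrE powR_ge0.
rewrite -(@powRK p b)//; apply: gt0_ltr_powR => //.
  by rewrite invr_gt0.
by rewrite nnegrE powR_ge0.
Qed.

Lemma ler_powRV p a b : 0 < p -> 0 <= a -> 0 <= b ->
  (a <= b `^ p^-1) = (a `^ p <= b).
Proof.
move=> p0 a0 b0; rewrite !leNgt; congr (~~ _).
by rewrite ltr_powRV.
Qed.

Lemma powRV_le p a b : 0 < p -> 0 <= a -> 0 <= b ->
  (a `^ p^-1 <= b) = (a <= b `^ p).
Proof.
move=> p0 a0 b0; apply/idP/idP => ab.
  rewrite -(@powRVK p a)//; apply: ge0_ler_powR => //; first exact: ltW.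
  by rewrite nnegrE powR_ge0.
rewrite -(@powRK p b)//; apply: ge0_ler_powR => //.
  by rewrite invr_ge0 ltW.
by rewrite nnegrE powR_ge0.
Qed.

End PowR.

(** * p-seminorms and their completions *)

(* [psn] is the [p]-th power of a [p]-seminorm, hence subadditive. *)
Record pseminorm {R : realType} (p : R) (V : lmodType R) := PSeminorm {
  psn :> V -> R;
  psn_exp_gt0 : 0 < p;
  psn_ge0 : forall v, 0 <= psn v;
  psnZ : forall a v, psn (a *: v) = `|a| `^ p * psn v;
  psnD : forall u v, psn (u + v) <= psn u + psn v }.

Section PseminormTheory.
Context {R : realType} {p : R} {V : lmodType R} (q : pseminorm p V).
Implicit Types u v w : V.

Lemma psn0 : q 0 = 0.
Proof.
by rewrite -(scale0r (0 : V)) psnZ normr0 powR0 ?mul0r ?gt_eqF ?(psn_exp_gt0 q).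
Qed.

Lemma psnN v : q (- v) = q v.
Proof. by rewrite -scaleN1r psnZ normrN normr1 powR1 mul1r. Qed.

Lemma psnB v w : q (v - w) = q (w - v).
Proof. by rewrite -psnN opprB. Qed.

Lemma psn_triangle w u v : q (u - v) <= q (u - w) + q (w - v).
Proof. 
have := psnD q (u-w) (w-v). rewrite addrA. rewrite subrK. exact. Qed.

Lemma psn_dist u v : `|q u - q v| <= q (u - v).
Proof.
have := psnD q (u - v) v; have := psnD q (v - u) u.
by rewrite !subrK (psnB v u) => h1 h2; rewrite ler_norml; apply/andP; split; lra.
Qed.

Definition psn_null : {pred V} := fun v => q v == 0.

Lemma psn_null_submod_closed : submod_closed psn_null.
Proof.
split=> [|a u v]; rewrite !unfold_in ?psn0// => /eqP u0 /eqP v0.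
rewrite eq_le psn_ge0 andbT (le_trans (psnD q _ _))// psnZ u0 v0.
by rewrite mulr0 addr0.
Qed.

HB.instance Definition _ := GRing.isSubmodClosed.Build R V psn_null
  psn_null_submod_closed.

Definition psn_quot := Quotient.quot psn_null.

HB.instance Definition _ := GRing.Zmodule.on psn_quot.

Definition quot_pi (v : V) : psn_quot := \pi_(Quotient.quot psn_null) v.

Lemma quot_piP (x : psn_quot) : {v | x = quot_pi v}.
Proof. by exists (repr x); rewrite /quot_pi reprK. Qed.

Lemma quot_piE u v : (quot_pi u == quot_pi v) = (q (u - v) == 0).
Proof. by rewrite -Quotient.idealrBE. Qed.

Lemma quot_piD u v : quot_pi (u + v) = quot_pi u + quot_pi v.
Proof. exact: raddfD. Qed.

Lemma quot_pi0 : quot_pi 0 = 0.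
Proof. exact: raddf0. Qed.

(** Scaling acts on canonical representatives. It is independent of this choice because the seminorm
    is homogeneous, which yields the module axioms below. *)
Definition quot_scale a (x : psn_quot) : psn_quot := quot_pi (a *: repr x).

Lemma repr_quot_pi v : q (repr (quot_pi v) - v) = 0.
Proof. by apply/eqP; rewrite -quot_piE /quot_pi reprK. Qed.

Lemma quot_scaleE a v : quot_scale a (quot_pi v) = quot_pi (a *: v).
Proof.
by apply/eqP; rewrite quot_piE -scalerBr psnZ repr_quot_pi mulr0.
Qed.

Lemma quot_scaleA a b x :
  quot_scale a (quot_scale b x) = quot_scale (a * b) x.
Proof. by have [v ->] := quot_piP x; rewrite !quot_scaleE scalerA. Qed.

Lemma quot_scale1 : left_id 1 quot_scale.
Proof. by move=> x; have [v ->] := quot_piP x; rewrite quot_scaleE scale1r. Qed.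

Lemma quot_scaleDr : right_distributive quot_scale +%R.
Proof.
move=> a x y; have [u ->] := quot_piP x; have [v ->] := quot_piP y.
by rewrite -quot_piD !quot_scaleE scalerDr quot_piD.
Qed.

Lemma quot_scaleDl x : {morph quot_scale^~ x : a b / a + b}.
Proof.
move=> a b; have [u ->] := quot_piP x.
by rewrite !quot_scaleE scalerDl quot_piD.
Qed.

HB.instance Definition _ := GRing.Zmodule_isLmodule.Build R psn_quot
  quot_scaleA quot_scale1 quot_scaleDr quot_scaleDl.

Lemma quot_piZ a v : quot_pi (a *: v) = a *: quot_pi v.
Proof. by rewrite -quot_scaleE. Qed.

Lemma quot_piB u v : quot_pi (u - v) = quot_pi u - quot_pi v.
Proof. by rewrite quot_piD -scaleN1r quot_piZ scaleN1r. Qed.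

Definition quot_psn (x : psn_quot) : R := q (repr x).

Lemma quot_psnE v : quot_psn (quot_pi v) = q v.
Proof.
apply/eqP; rewrite -subr_eq0 -normr_le0.
by rewrite (le_trans (psn_dist _ _))// repr_quot_pi.
Qed.

End PseminormTheory.

Section Completion.
Context {R : realType} {p : R} {V : lmodType R} (q : pseminorm p V).

Definition cauchy_seq (v : nat -> V) := forall e : R, 0 < e ->
  exists N, forall n m, (N <= n)%N -> (N <= m)%N -> q (v n - v m) < e.

Definition cauchy_pred : {pred nat -> V} := fun v => `[< cauchy_seq v >].

Lemma cauchy_submod_closed : submod_closed cauchy_pred.
Proof.
split=> [|a u v]; rewrite !unfold_in.
  by apply/asboolP => e e0; exists 0%N => n m _ _; rewrite subrr psn0.
move=> /asboolP cu /asboolP cv; apply/asboolP => e e0.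
(* The summand 1 keeps the divisor positive when a = 0. *)
have a0 : 0 < `|a| `^ p + 1 by rewrite ltr_wpDl// powR_ge0.
have e2 : 0 < e / 2 by rewrite divr_gt0.
have [N1 h1] := cu _ (divr_gt0 e2 a0); have [N2 h2] := cv _ e2.
exists (maxn N1 N2) => n m; rewrite !geq_max => /andP[n1 n2] /andP[m1 m2].
have := h2 n m n2 m2; have := h1 n m n1 m1.
rewrite ltr_pdivlMr// => {}h1 {}h2.
have -> : (a *: u + v) n - (a *: u + v) m = a *: (u n - u m) + (v n - v m).
  by rewrite !fctE /= scalerBr opprD addrACA.
rewrite (le_lt_trans (psnD _ _ _))// psnZ.
have := psn_ge0 q (u n - u m); nra.
Qed.

HB.instance Definition _ := GRing.isSubmodClosed.Build R (nat -> V) cauchy_pred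
  cauchy_submod_closed.

(** Sequences at limit distance zero are still distinct here; they are identified only on passing to
    [psn_quot]. *)
Record cauchy_space := CauchySeq {
  cauchy_val :> nat -> V;
  _ : cauchy_val \in cauchy_pred }.

HB.instance Definition _ := [isSub for cauchy_val].
HB.instance Definition _ := [Choice of cauchy_space by <:].
HB.instance Definition _ := [SubChoice_isSubLmodule of cauchy_space by <:].

Lemma cauchy_spaceP (u : cauchy_space) : cauchy_seq u.
Proof. by case: u => u /= /asboolP. Qed.

(** By the reverse triangle inequality [psn_dist], the values of q along u form a Cauchy sequence of
    reals. *)
Lemma cauchy_is_cvg (u : cauchy_space) : cvgn (fun n => q (u n)).
Proof.
apply: cauchy_cvg; apply: cauchy_exP => e e0.
have [N h] := cauchy_spaceP u e0.
exists (q (u N)); exists N => // n Nn /=.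
by apply: le_lt_trans (psn_dist _ _ _) _; exact: h.
Qed.

Definition lim_psn (u : cauchy_space) : R := limn (fun n => q (u n)).

Lemma lim_psn_le (u : cauchy_space) (e : R) N :
  (forall n, (N <= n)%N -> q (u n) <= e) -> lim_psn u <= e.
Proof.
move=> h; apply: limr_le; first exact: cauchy_is_cvg.
by exists N => // n; exact: h.
Qed.

Lemma lim_psn_lt (u : cauchy_space) (e : R) : lim_psn u < e ->
  exists N, forall n, (N <= n)%N -> q (u n) < e.
Proof.
move=> ue; have /cvgrPdist_lt/(_ (e - lim_psn u)) := @cauchy_is_cvg u.
rewrite subr_gt0 => /(_ ue)[N _ h]; exists N => n /h /=.
rewrite -/(lim_psn u) => /ltr_distlCDr; rewrite addrC subrK; exact.
Qed.

Lemma lim_psn_ge0 u : 0 <= lim_psn u.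
Proof.
apply: limr_ge; first exact: cauchy_is_cvg.
by apply: nearW => n; exact: psn_ge0.
Qed.

Lemma lim_psnZ a u : lim_psn (a *: u) = `|a| `^ p * lim_psn u.
Proof.
apply/cvg_lim => //.
rewrite (_ : (fun n => _) = (fun n => `|a| `^ p * q (u n))).
  by apply: cvgMr; exact: cauchy_is_cvg.
by apply/funext => n; rewrite -psnZ.
Qed.

Lemma lim_psnD u v : lim_psn (u + v) <= lim_psn u + lim_psn v.
Proof.
rewrite -limD; [|exact: cauchy_is_cvg..].
apply: ler_lim; [exact: cauchy_is_cvg| |].
  by apply: is_cvgD; exact: cauchy_is_cvg.
by apply: nearW => n; exact: psnD.
Qed.

Definition cauchy_psn : pseminorm p cauchy_space :=
  PSeminorm (psn_exp_gt0 q) lim_psn_ge0 lim_psnZ lim_psnD.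

Lemma cst_cauchy v : cst v \in cauchy_pred.
Proof. by apply/asboolP => e e0; exists 0%N => n m _ _; rewrite subrr psn0. Qed.

Definition cauchy_cst v : cauchy_space := CauchySeq (cst_cauchy v).

Lemma cauchy_psn_cst v : cauchy_psn (cauchy_cst v) = q v.
Proof.
by apply/cvg_lim => //=; apply: cvg_cst.
Qed.

Lemma cauchy_cstB u v : cauchy_cst (u - v) = cauchy_cst u - cauchy_cst v.
Proof. exact: val_inj. Qed.

Lemma cauchy_cst_sum (I : Type) (r : seq I) (c : I -> R) (f : I -> V) :
  cauchy_cst (\sum_(i <- r) c i *: f i) =
  \sum_(i <- r) c i *: cauchy_cst (f i).
Proof.
elim: r => [|i r ih]; first by rewrite !big_nil; exact: val_inj.
by rewrite !big_cons -ih; exact: val_inj.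
Qed.

(** Diagonal argument: the limit takes from the k-th sequence one term beyond which that sequence
    varies by less than 1/(k+1). *)
Lemma cauchy_complete (u : nat -> cauchy_space) :
  (forall e : R, 0 < e -> exists N, forall n m, (N <= n)%N -> (N <= m)%N ->
    cauchy_psn (u n - u m) < e) ->
  exists l, forall e : R, 0 < e -> exists N, forall n, (N <= n)%N ->
    cauchy_psn (u n - l) < e.
Proof.
move=> uC.
have /choice[N hN] (k : nat) : exists N, forall n m, (N <= n)%N -> (N <= m)%N ->
    q (u k n - u k m) < k.+1%:R^-1.
  by apply: cauchy_spaceP; rewrite invr_gt0.
have close (e : R) : 0 < e -> exists K, forall k m, (K <= k)%N -> (K <= m)%N ->
    exists n0, forall n, (n0 <= n)%N -> q (u k n - u m n) < e.
  move=> /uC[K hK]; exists K => k m Kk Km.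
  by have [n0 h] := lim_psn_lt (hK _ _ Kk Km); exists n0.
have small (e : R) : 0 < e -> exists K : nat, forall k, (K <= k)%N ->
    (k.+1%:R^-1 : R) < e.
  move=> e0; have [K _ hK] := near_infty_natSinv_lt (PosNum e0).
  by exists K => k /hK.
pose l k := u k (N k).
(* [l k] is within [1/(k+1)] of the tail of the [k]-th Cauchy sequence. *)
have near_l (e : R) : 0 < e -> exists K, forall k m, (K <= k)%N -> (K <= m)%N ->
    forall n, (N k <= n)%N -> q (u k n - l m) < e.
  move=> e0; have e4 : 0 < e / 4 by rewrite divr_gt0.
  have [K1 h1] := close _ e4; have [K2 h2] := small _ e4.
  exists (maxn K1 K2) => k m; rewrite !geq_max => /andP[k1 k2] /andP[m1 m2] n kn.
  have [n0 h0] := h1 k m k1 m1.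
  (* At the common index M the k-th and m-th sequences are compared; the path from [u k n] to [l m]
     through [u k M] and [u m M] has three pieces, each below e/4. *)
  pose M := maxn n0 (maxn (N k) (N m)).
  have Mn0 : (n0 <= M)%N by rewrite leq_maxl.
  have MNk : (N k <= M)%N by rewrite !leq_max leqnn orbT.
  have MNm : (N m <= M)%N by rewrite !leq_max leqnn !orbT.
  have := psn_triangle q (u k M) (u k n) (l m).
  have := psn_triangle q (u m M) (u k M) (l m).
  have := hN k n M kn MNk; have := hN m M (N m) MNm (leqnn _).
  have := h0 M Mn0; have := h2 k k2; have := h2 m m2.
  rewrite /l; move: (m.+1%:R^-1) (k.+1%:R^-1) => i j.
  move: (q (u k M - u m M)) (q (u m M - u m (N m))) (q (u k n - u k M)).
  move: (q (u k M - u m (N m))) (q (u k n - u m (N m))) => *; lra.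
have lC : l \in cauchy_pred.
  apply/asboolP => e e0; have [K hK] := near_l _ e0.
  by exists K => n m Kn Km; exact: hK.
exists (CauchySeq lC) => e e0.
have e2 : 0 < e / 2 by rewrite divr_gt0.
have [K hK] := near_l _ e2; exists K => k Kk.
(* Passing to the limit only preserves a weak inequality, hence the bound e/2. *)
apply: (@le_lt_trans _ _ (e / 2)); last by rewrite ltr_pdivrMr// ltr_pMr// ltr1n.
apply: (@lim_psn_le _ _ (maxn K (N k))) => n; rewrite geq_max => /andP[Kn Nn].
exact/ltW/hK.
Qed.

End Completion.

Section BanachCompletion.
Context {p : RR} {V : lmodType RR} (q : pseminorm p V).
Let C := cauchy_space q.
Let B := psn_quot (cauchy_psn q).

(** A [pseminorm] is a p-th power, so the root restores homogeneity of degree one. *)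
Definition banach_norm (x : B) : RR := quot_psn x `^ p^-1.

Let p0 : 0 < p := psn_exp_gt0 q.

Lemma banach_normE (v : C) :
  banach_norm (quot_pi (cauchy_psn q) v) = cauchy_psn q v `^ p^-1.
Proof. by rewrite /banach_norm quot_psnE. Qed.

Lemma banach_normK (x : B) : banach_norm x `^ p = quot_psn x.
Proof. by rewrite powRVK// /quot_psn psn_ge0. Qed.

Lemma banach_norm_pnorm : is_pnorm p banach_norm.
Proof.
split=> [x|x|a x|x y].
- exact: powR_ge0.
- have [v ->] := quot_piP x; rewrite banach_normE => /powR_eq0_eq0 v0.
  by apply/eqP; rewrite -(quot_pi0 (cauchy_psn q)) quot_piE subr0 v0.
- have [v ->] := quot_piP x; rewrite -quot_piZ !banach_normE psnZ.
  by rewrite powRM ?powR_ge0 ?psn_ge0// powRK.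
- rewrite !banach_normK; have [u ->] := quot_piP x; have [v ->] := quot_piP y.
  by rewrite -quot_piD !quot_psnE psnD.
Qed.

Lemma banach_norm_complete : pnorm_complete banach_norm.
Proof.
move=> u uC.
pose v n : C := projT1 (quot_piP (u n)).
have uv n : u n = quot_pi (cauchy_psn q) (v n) by exact: projT2 (quot_piP (u n)).
have lt_normE (w z : C) (e : RR) : 0 <= e ->
    (banach_norm (quot_pi (cauchy_psn q) w - quot_pi (cauchy_psn q) z) < e) =
    (cauchy_psn q (w - z) < e `^ p).
  by move=> e0; rewrite -quot_piB banach_normE ltr_powRV// psn_ge0.
have [e e0|l hl] := @cauchy_complete _ _ _ q v.
  have [N hN] := uC (e `^ p^-1) (powR_gt0 _ e0); exists N => n m Nn Nm.
  by have := hN n m Nn Nm; rewrite !uv lt_normE ?powR_ge0// powRVK// ltW.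
exists (quot_pi (cauchy_psn q) l) => e e0.
have [N hN] := hl (e `^ p) (powR_gt0 _ e0); exists N => n Nn.
by rewrite uv lt_normE ?(ltW e0)// hN.
Qed.

Definition banach_completion : pBanach p :=
  PBanach banach_norm_pnorm banach_norm_complete.

End BanachCompletion.

(* [V] need be neither Hausdorff nor complete: the test space is its completion. *)
Lemma Fp_norm_ge (p : RR) (V : lmodType RR) (q : pseminorm p V)
    (M : Type) (dM : M -> M -> RR) (m0 : M) (f : M -> V) (mu : seq (RR * M)) :
  (forall a b, 0 <= dM a b) ->
  (forall a b, q (f a - f b) <= dM a b `^ p) ->
  ((q (\sum_(i <- mu) i.1 *: (f i.2 - f m0)) `^ p^-1)%:E <= Fp_norm p dM m0 mu)%E.
Proof.
move=> d0 fd; apply: ereal_sup_ubound.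
(* Subtracting [f m0] makes the map pointed and leaves differences unchanged; constant sequences
   carry V into its completion without changing q. *)
pose F a := quot_pi (cauchy_psn q) (cauchy_cst q (f a - f m0)).
exists (banach_completion q), F; split.
  split=> [|a b] /=.
    apply/eqP; rewrite -(quot_pi0 (cauchy_psn q)) quot_piE subr0.
    by rewrite cauchy_psn_cst subrr psn0.
  rewrite -quot_piB -cauchy_cstB banach_normE cauchy_psn_cst.
  by rewrite powRV_le ?psn_ge0 ?(psn_exp_gt0 q)// opprB addrA subrK.
congr (_%:E); rewrite /= -(cauchy_psn_cst q) -banach_normE; congr banach_norm.
rewrite cauchy_cst_sum; elim: mu => [|i r ih].
  by rewrite !big_nil; exact: quot_pi0.
by rewrite !big_cons quot_piD quot_piZ -ih.
Qed.

Lemma Fp_norm_le (p : RR) (M : Type) (dM : M -> M -> RR) (m0 : M)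
    (mu : seq (RR * M)) (s : RR) : 0 < p -> 0 <= s ->
  (forall (Y : pBanach p) (f : M -> pb_carrier Y),
    lip1_pointed dM m0 (@pb_norm p Y) f ->
    pb_norm (\sum_(i <- mu) i.1 *: f i.2) `^ p <= s) ->
  (Fp_norm p dM m0 mu <= (s `^ p^-1)%:E)%E.
Proof.
move=> p0 s0 h; apply: ge_ereal_sup => _ [Y [f [lf ->]]].
by rewrite lee_fin ler_powRV//; [exact: h|case: (pb_pnorm Y)].
Qed.

(** * The spaces L_p for p <= 1 *)

Section LpSeminorm.
Context d {T : measurableType d} {R : realType}.
Variables (mu : {measure set T -> \bar R}) (p : R).
Implicit Types f g : {mfun T >-> R}.

Definition powint (f : T -> R) : \bar R := (\int[mu]_x (`|f x| `^ p)%:E)%E.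

(* The bounds on [p] are arguments so that instance resolution, which cannot
   synthesise proofs, recovers them from the type. *)
Definition powint_fin of 0 < p & p <= 1 : {pred {mfun T >-> R}} :=
  fun f => (powint f < +oo)%E.

Let mpow f : measurable_fun [set: T] (fun x => (`|f x| `^ p)%:E : \bar R).
Proof.
apply/measurable_EFinP.
have mf : measurable_fun [set: T] (fun x => `|f x|) by exact: measurableT_comp.
exact: (measurableT_comp (measurable_powR p) mf).
Qed.

Lemma powint_ge0 (f : T -> R) : (0 <= powint f)%E.
Proof. by apply: integral_ge0 => x _; rewrite lee_fin powR_ge0. Qed.

Lemma powintZ a f : powint (a *: f) = ((`|a| `^ p)%:E * powint f)%E.
Proof.
rewrite -ge0_integralZl_EFin ?powR_ge0//.
apply: eq_integral => x _ /=.
by rewrite -EFinM -powRM// -normrM.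
Qed.

Hypotheses (p0 : 0 < p) (p1 : p <= 1).

Lemma powintD f g : (powint (f \+ g)%R <= powint f + powint g)%E.
Proof.
rewrite /powint -ge0_integralD//.
apply: ge0_le_integral => //.
- exact: emeasurable_funD.
- by move=> x _; rewrite -EFinD lee_fin ler_normD_powR.
Qed.

Lemma powint_submod_closed : submod_closed (powint_fin p0 p1).
Proof.
split=> [|a f g]; rewrite !unfold_in.
  rewrite /powint (eq_integral (cst 0%E)) ?integral0 ?ltry// => x _ /=.
  by rewrite normr0 powR0 ?gt_eqF.
move=> ff fg; apply: le_lt_trans (powintD (a *: f) g) _.
by rewrite powintZ lte_add_pinfty// lte_mul_pinfty// lee_fin powR_ge0.
Qed.

HB.instance Definition _ := GRing.isSubmodClosed.Build R {mfun T >-> R}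
  (powint_fin p0 p1) powint_submod_closed.

Record Lp_fun := LpFun { Lp_val :> {mfun T >-> R}; _ : Lp_val \in powint_fin p0 p1 }.

HB.instance Definition _ := [isSub for Lp_val].
HB.instance Definition _ := [Choice of Lp_fun by <:].
HB.instance Definition _ := [SubChoice_isSubLmodule of Lp_fun by <:].

Lemma Lp_fin (u : Lp_fun) : (powint u \is a fin_num)%E.
Proof. by rewrite ge0_fin_numE ?powint_ge0//; case: u. Qed.

Definition Lp_psn_val (u : Lp_fun) : R := fine (powint u).

Lemma Lp_psn_ge0 u : 0 <= Lp_psn_val u.
Proof. exact/fine_ge0/powint_ge0. Qed.

Lemma Lp_psnZ a u : Lp_psn_val (a *: u) = `|a| `^ p * Lp_psn_val u.
Proof. by rewrite /Lp_psn_val powintZ fineM// Lp_fin. Qed.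

Lemma Lp_psnD u v : Lp_psn_val (u + v) <= Lp_psn_val u + Lp_psn_val v.
Proof.
have := powintD u v.
rewrite -[powint (_ \+ _)]/(powint (u + v : Lp_fun)).
rewrite -(fineK (Lp_fin u)) -(fineK (Lp_fin v)) -(fineK (Lp_fin (u + v))).
by rewrite -EFinD lee_fin.
Qed.

Definition Lp_psn : pseminorm p Lp_fun :=
  PSeminorm p0 Lp_psn_ge0 Lp_psnZ Lp_psnD.

End LpSeminorm.

(** * The half-line as a curve of indicators in L_p *)

Section IntervalIndicators.
Context {R : realType} (p : R) (p0 : 0 < p) (p1 : p <= 1).
Local Notation mu := (@lebesgue_measure R).

(** Only the modulus of f is prescribed, so that differences of indicators are covered whatever
    their sign. *)
Lemma powint_itv (f : measurableTypeR R -> R) (c s t : R) : s <= t ->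
  (forall x, `|f x| = c * \1_(`[s, t[ : set R) x) ->
  powint mu p f = (`|c| `^ p * (t - s))%:E.
Proof.
move=> st fc; rewrite /powint.
rewrite (eq_integral (fun x : measurableTypeR R =>
    (`|c| `^ p)%:E * (\1_(`[s, t[ : set R) x)%:E)%E).
  rewrite ge0_integralZl_EFin ?powR_ge0//; last first.
    by apply/measurable_EFinP; exact: measurable_indic.
  rewrite integral_indic// setIT EFinM; congr (_ * _)%E.
  rewrite [LHS](lebesgue_measure_itv `[s, t[%R) /= lte_fin.
  by case: ltP => // ts; rewrite (le_anti (introT andP (conj st ts))) subrr.
move=> x _; rewrite -EFinM; congr (_%:E).
rewrite -(normr_id (f x)) fc indicE; case: (_ \in _).
  by rewrite !mulr1.
by rewrite !mulr0 normr0 powR0 ?gt_eqF.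
Qed.

Let measurable_Ico t :
  @measurable _ (measurableTypeR R) [set` `[0, t[%R].
Proof. exact: measurable_itv. Qed.

Definition chi_mfun (t : R) : {mfun (measurableTypeR R) >-> R} :=
  mindic R (measurable_Ico t).

Lemma chi_fin t : chi_mfun t \in powint_fin mu p0 p1.
Proof.
rewrite unfold_in; have [t0|t0] := leP 0 t.
  rewrite (@powint_itv _ 1 0 t) ?ltry// => x.
  by rewrite /= /mindic ger0_norm// mul1r.
(* For t < 0 the interval is empty, as is [0,0[. *)
rewrite (@powint_itv _ 1 0 0) ?ltry// => x.
rewrite /= /mindic !set_itv_ge ?indic0 ?normr0 ?mulr0// -leNgt//.
by rewrite bnd_simp ltW.
Qed.

Definition chi t : Lp_fun mu p0 p1 := LpFun (chi_fin t).

Lemma Lp_psn_chi a t : 0 <= t -> Lp_psn mu p0 p1 (a *: chi t) = `|a| `^ p * t.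
Proof.
move=> t0; rewrite psnZ; congr (_ * _); rewrite /= /Lp_psn_val.
rewrite (@powint_itv _ 1 0 t)//= ?normr1 ?powR1 ?mul1r ?subr0// => x.
by rewrite /mindic ger0_norm// mul1r.
Qed.

(** The difference has modulus 1 exactly on the interval between s and t. Thus p-th powers of L_p
    distances reproduce the usual metric of the half-line. *)
Lemma Lp_psn_chiB s t : 0 <= s -> 0 <= t ->
  Lp_psn mu p0 p1 (chi s - chi t) = `|s - t|.
Proof.
wlog st : s t / s <= t.
  move=> h s0 t0; have [|/ltW] := leP s t => st; first exact: h.
  by rewrite psnB distrC h.
move=> s0 t0; rewrite distrC ger0_norm ?subr_ge0// /= /Lp_psn_val.
rewrite (@powint_itv _ 1 s t)//= ?normr1 ?powR1 ?mul1r// => x.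
rewrite mul1r /= !fctE /mindic !indicE !mem_setE !in_itv/=.
have [x0|x0] := leP 0 x; have [xs|sx] := ltP x s; have [xt|tx] := ltP x t.
all: rewrite ?subrr ?sub0r ?normrN ?normr1 ?normr0//=; lra.
Qed.


End IntervalIndicators.

Section ProductSeminorm.
Context {R : realType} {p : R} {V W : lmodType R}.
Variables (q : pseminorm p V) (r : pseminorm p W).

Definition prod_psn_val (v : V * W) : R := q v.1 + r v.2.

Lemma prod_psn_ge0 v : 0 <= prod_psn_val v.
Proof. by rewrite addr_ge0 ?psn_ge0. Qed.

Lemma prod_psnZ a v : prod_psn_val (a *: v) = `|a| `^ p * prod_psn_val v.
Proof. by rewrite /prod_psn_val !psnZ -mulrDr. Qed.

Lemma prod_psnD u v : prod_psn_val (u + v) <= prod_psn_val u + prod_psn_val v.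
Proof. by rewrite /prod_psn_val addrACA lerD ?psnD. Qed.

Definition prod_psn : pseminorm p (V * W)%type :=
  PSeminorm (psn_exp_gt0 q) prod_psn_ge0 prod_psnZ prod_psnD.

End ProductSeminorm.

(** * The tripod *)

Section Mass.
Context {T : Type}.

(** The total coefficient of delta(u) in [mu]; equality on the arbitrary type [T] is decided
    classically. *)
Definition mass (mu : seq (RR * T)) (u : T) : RR :=
  \sum_(i <- mu | `[< i.2 = u >]) i.1.

Lemma sum_mass (V : lmodType RR) (o x y : T) (f : T -> V) (mu : seq (RR * T)) :
  o <> x -> o <> y -> x <> y -> (forall t, t = o \/ t = x \/ t = y) -> f o = 0 ->
  \sum_(i <- mu) i.1 *: f i.2 = mass mu x *: f x + mass mu y *: f y.
Proof.
move=> ox oy xy oxy fo; rewrite /mass; elim: mu => [|[a t] mu ih].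
  by rewrite !big_nil !scale0r addr0.
rewrite !big_cons /= ih.
have [->|[->|->]] := oxy t.
- by rewrite fo scaler0 add0r !asboolF.
- by rewrite asboolT// asboolF// scalerDl addrA.
- by rewrite asboolF ?asboolT// => [|/esym//]; rewrite scalerDl addrCA.
Qed.

End Mass.

Section Legs.
Context {R : realType}.

Definition leg (l a : R) : R := Num.max 0 (l - a).

Lemma leg_ge0 l a : 0 <= leg l a.
Proof. by rewrite le_max lexx. Qed.

Lemma legP l a : (l <= a /\ leg l a = 0) \/ (a < l /\ leg l a = l - a).
Proof.
by rewrite /leg; have [la|al] := leP l a; [left|right]; split=> //;
  [rewrite max_l// subr_le0|rewrite max_r// subr_ge0 ltW].
Qed.

Lemma leg_dist l a b D : a <= b + D -> b <= a + D -> 0 <= D ->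
  `|leg l a - leg l b| <= D.
Proof.
move=> abD baD D0; rewrite ler_norml; apply/andP.
by case: (legP l a) => -[? ->]; case: (legP l b) => -[? ->]; split; lra.
Qed.

(* [leg l_i a_i] is the coordinate, on the leg of length [l_i], of the image in
   the tripod of a point at distances [a_i] from the three endpoints. *)
Lemma tripod_dist (l1 l2 l3 a1 a2 a3 b1 b2 b3 D : R) : 0 <= D ->
  a1 <= b1 + D -> b1 <= a1 + D -> a2 <= b2 + D -> b2 <= a2 + D ->
  a3 <= b3 + D -> b3 <= a3 + D ->
  l1 + l2 <= a1 + a2 -> l1 + l3 <= a1 + a3 -> l2 + l3 <= a2 + a3 ->
  l1 + l2 <= b1 + b2 -> l1 + l3 <= b1 + b3 -> l2 + l3 <= b2 + b3 ->
  l1 + l2 <= a1 + D + b2 -> l1 + l2 <= b1 + D + a2 ->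
  l1 + l3 <= a1 + D + b3 -> l1 + l3 <= b1 + D + a3 ->
  l2 + l3 <= a2 + D + b3 -> l2 + l3 <= b2 + D + a3 ->
  `|leg l1 a1 - leg l1 b1| + `|leg l2 a2 - leg l2 b2| +
  `|leg l3 a3 - leg l3 b3| <= D.
Proof.
move=> D0 h1 h1' h2 h2' h3 h3' ? ? ? ? ? ? ? ? ? ? ? ?.
have n1 := leg_dist l1 h1 h1' D0; have n2 := leg_dist l2 h2 h2' D0.
have n3 := leg_dist l3 h3 h3' D0.
have nB l a b : `|leg l a - leg l b| <= leg l a + leg l b.
  by rewrite (le_trans (ler_normB _ _))// !ger0_norm ?leg_ge0.
move: n1 n2 n3 (nB l1 a1 b1) (nB l2 a2 b2) (nB l3 a3 b3).
move: `|leg l1 a1 - leg l1 b1| `|leg l2 a2 - leg l2 b2| `|leg l3 a3 - leg l3 b3|.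
move=> n1 n2 n3.
(* Since l_i + l_j <= a_i + a_j, and likewise for b, each point has at most one nonzero leg
   coordinate. On a common leg [leg_dist] suffices; on distinct legs i and j the bound is l_i + l_j
   <= a_i + D + b_j or its mirror image. *)
case: (legP l1 a1) => -[? ->]; case: (legP l2 a2) => -[? ->];
  case: (legP l3 a3) => -[? ->]; try lra;
  case: (legP l1 b1) => -[? ->]; case: (legP l2 b2) => -[? ->];
  case: (legP l3 b3) => -[? ->]; lra.
Qed.

End Legs.

Lemma chi0 {R : realType} (p : R) (p0 : 0 < p) (p1 : p <= 1) : chi p0 p1 0 = 0.
Proof.
apply/val_inj/mfuneqP => x.
by rewrite /= /mindic set_itv_ge ?bnd_simp ?ltxx// indic0.
Qed.

Section PMetric.
Context {p : RR} {M : Type} {dM : M -> M -> RR} (hd : is_pmetric p dM).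
Implicit Types u v w : M.

Lemma pmetric_ge0 u v : 0 <= dM u v. Proof. by case: hd. Qed.

Lemma pmetricxx u : dM u u `^ p = 0. Proof. by case: hd => _ h _ _; apply/h. Qed.

Lemma pmetricC u v : dM u v `^ p = dM v u `^ p. Proof. by case: hd. Qed.

Lemma pmetricD w u v : dM u v `^ p <= dM u w `^ p + dM w v `^ p.
Proof. by case: hd. Qed.

Lemma pmetric_gt0 u v : u <> v -> 0 < dM u v `^ p.
Proof.
move=> uv; rewrite lt_neqAle powR_ge0 andbT eq_sym.
by apply/eqP; case: hd => _ h _ _ /h.
Qed.

End PMetric.

(** This is S(mu), with a and b the masses at x and y. *)
Definition tripod_pow {R : realType} (p lo lx ly a b : R) : R :=
  `|a + b| `^ p * lo + `|a| `^ p * lx + `|b| `^ p * ly.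

Lemma tripod_pow_ge0 {R : realType} (p lo lx ly a b : R) :
  0 <= lo -> 0 <= lx -> 0 <= ly -> 0 <= tripod_pow p lo lx ly a b.
Proof. by move=> *; rewrite !addr_ge0 ?mulr_ge0 ?powR_ge0. Qed.

(** * The lower bound S in every extension *)

Section LowerBound.
Context {p : RR} (p0 : 0 < p) (p1 : p <= 1).
Context {M : Type} {dM : M -> M -> RR} (hM : is_pmetric p dM).
Variables (o x y : M) (lo lx ly : RR).
Hypotheses (lo0 : 0 <= lo) (lx0 : 0 <= lx) (ly0 : 0 <= ly).
Hypotheses (dox : lo + lx = dM o x `^ p) (doy : lo + ly = dM o y `^ p)
  (dxy : lx + ly = dM x y `^ p).

Let q := Lp_psn (@lebesgue_measure RR) p0 p1.
Let Q := prod_psn (prod_psn q q) q.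
Let c := chi p0 p1.

(** The retraction onto the tripod followed by its embedding: each leg occupies its own copy of L_p,
    and the centre goes to 0. *)
Definition tripod_map (z : M) :=
  (c (leg lo (dM o z `^ p)), c (leg lx (dM x z `^ p)), c (leg ly (dM y z `^ p))).

Lemma tripod_map_lip z w : Q (tripod_map z - tripod_map w) <= dM z w `^ p.
Proof.
rewrite -[leLHS]/(q (c _ - c _) + q (c _ - c _) + q (c _ - c _)).
rewrite !Lp_psn_chiB ?leg_ge0//.
have a u : dM u z `^ p <= dM u w `^ p + dM z w `^ p.
  by rewrite (pmetricC hM z w) (pmetricD hM).
have b u : dM u w `^ p <= dM u z `^ p + dM z w `^ p by rewrite (pmetricD hM).
have e u v t : dM u v `^ p <= dM u t `^ p + dM v t `^ p.
  by rewrite (pmetricC hM v t) (pmetricD hM).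
have f u v : dM u v `^ p <= dM u z `^ p + dM z w `^ p + dM v w `^ p.
  by have := e u v w; have := b u; lra.
have g u v : dM u v `^ p <= dM u w `^ p + dM z w `^ p + dM v z `^ p.
  by have := e u v z; have := a u; lra.
by apply: tripod_dist; rewrite ?dox ?doy ?dxy ?powR_ge0.
Qed.

(** The points o, x, y go to the tips of the three legs, so the combination has components -(a + b),
    a and b times the respective full-leg indicators. *)
Lemma tripod_mapE a b :
  Q (a *: (tripod_map x - tripod_map o) + b *: (tripod_map y - tripod_map o)) =
  tripod_pow p lo lx ly a b.
Proof.
have legxx l : 0 <= l -> c (leg l 0) = c l.
  by move=> l0; rewrite /leg subr0 max_r.
have legz l u v s : l + s = dM u v `^ p -> 0 <= s -> c (leg l (dM u v `^ p)) = 0.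
  by move=> <- s0; rewrite /leg max_l ?[c 0]chi0//; lra.
have oz : tripod_map o = (c lo, 0, 0).
  rewrite /tripod_map (pmetricxx hM) legxx//.
  by rewrite (@legz lx _ _ lo) ?(@legz ly _ _ lo)// ?(pmetricC hM _ o) addrC.
have xz : tripod_map x = (0, c lx, 0).
  rewrite /tripod_map (pmetricxx hM) legxx//.
  by rewrite (@legz lo _ _ lx)// (@legz ly _ _ lx)// (pmetricC hM y) addrC.
have yz : tripod_map y = (0, 0, c ly).
  rewrite /tripod_map (pmetricxx hM) legxx//.
  by rewrite (@legz lo _ _ ly)// (@legz lx _ _ ly).
rewrite oz xz yz.
have -> : a *: ((0, c lx, 0) - (c lo, 0, 0)) + b *: ((0, 0, c ly) - (c lo, 0, 0)) =
    (- (a + b) *: c lo, a *: c lx, b *: c ly).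
  congr (_, _, _) => /=.
  - by rewrite !sub0r !scalerN scaleNr scalerDl opprD.
  - by rewrite !subr0 scaler0 addr0.
  - by rewrite !subr0 scaler0 add0r.
rewrite -[LHS]/(q (_ *: c lo) + q (_ *: c lx) + q (_ *: c ly)).
by rewrite !Lp_psn_chi// normrN.
Qed.

End LowerBound.

Lemma tripod_le_Fp_norm (p : RR) (M T : Type) (dM : M -> M -> RR) (j : T -> M)
    (o x y : T) (lo lx ly : RR) (mu : seq (RR * T)) :
  0 < p -> p <= 1 -> is_pmetric p dM ->
  o <> x -> o <> y -> x <> y -> (forall t, t = o \/ t = x \/ t = y) ->
  0 <= lo -> 0 <= lx -> 0 <= ly ->
  lo + lx = dM (j o) (j x) `^ p -> lo + ly = dM (j o) (j y) `^ p ->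
  lx + ly = dM (j x) (j y) `^ p ->
  ((tripod_pow p lo lx ly (mass mu x) (mass mu y) `^ p^-1)%:E <=
   Fp_norm p dM (j o) [seq (i.1, j i.2) | i <- mu])%E.
Proof.
move=> p0 p1 hM ox oy xy oxy lo0 lx0 ly0 dox doy dxy.
pose F := @tripod_map p p0 p1 M dM (j o) (j x) (j y) lo lx ly.
rewrite -(tripod_mapE p0 p1 hM lo0 lx0 ly0 dox doy dxy) -/F.
rewrite -(@sum_mass _ _ o x y (fun t => F (j t) - F (j o)))// ?subrr//.
apply: le_trans (Fp_norm_ge (j o) _ (pmetric_ge0 hM)
  (tripod_map_lip p0 p1 hM dox doy dxy)).
by rewrite big_map.
Qed.

(** * Optimal flows on three points *)

Section StrictInequality.
Context {R : realType} (p : R) (p0 : 0 < p) (p1 : p <= 1).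
Variables (a b c : R) (a0 : 0 <= a) (b0 : 0 <= b) (c0 : 0 <= c).

(* Cost of transporting masses [v.1], [v.2] to the origin when an amount [s] is
   routed along the edge joining the two other points. *)
Definition flow_cost (v : R^o * R^o) (s : R) : R :=
  `|v.1 - s| `^ p * a + `|v.2 + s| `^ p * b + `|s| `^ p * c.

(** Writing v = (v.1 - s)(1,0) + (v.2 + s)(0,1) + s(1,-1) shows that this infimum is the largest
    p-seminorm, in p-th power, with values at most a, b, c at these three vectors. *)
Definition flow_psn_val (v : R^o * R^o) : R := inf (range (flow_cost v)).

Lemma flow_cost_ge0 v s : 0 <= flow_cost v s.
Proof. by rewrite !addr_ge0 ?mulr_ge0 ?powR_ge0. Qed.

Lemma flow_psn_le v s : flow_psn_val v <= flow_cost v s.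
Proof.
apply: ge_inf; last by exists s.
by exists 0 => _ [t _ <-]; exact: flow_cost_ge0.
Qed.

Lemma flow_psn_ge v e : (forall s, e <= flow_cost v s) -> e <= flow_psn_val v.
Proof.
move=> h; apply: lb_le_inf; first by exists (flow_cost v 0), 0.
by move=> _ [t _ <-].
Qed.

Lemma flow_psn_ge0 v : 0 <= flow_psn_val v.
Proof. exact/flow_psn_ge/flow_cost_ge0. Qed.

Lemma flow_costZ k v s : flow_cost (k *: v) (k * s) = `|k| `^ p * flow_cost v s.
Proof.
rewrite /flow_cost /= -[k *: v.1]/(k * v.1) -[k *: v.2]/(k * v.2).
by rewrite -mulrBr -mulrDr !normrM !powRM// !mulrDr !mulrA.
Qed.

(** Scaling a flow along with v gives one inequality for every factor; applied to the inverse of k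
    it gives the other. *)
Lemma flow_psnZ k v : flow_psn_val (k *: v) = `|k| `^ p * flow_psn_val v.
Proof.
have le k' v' : flow_psn_val (k' *: v') <= `|k'| `^ p * flow_psn_val v'.
  have [->|k0] := eqVneq k' 0.
    rewrite normr0 powR0 ?gt_eqF// mul0r (le_trans (flow_psn_le _ (0 * 0)))//.
    by rewrite flow_costZ normr0 powR0 ?gt_eqF// mul0r.
  have k0' : 0 < `|k'| `^ p by rewrite powR_gt0// normr_gt0.
  rewrite -ler_pdivrMl//; apply: flow_psn_ge => s.
  by rewrite ler_pdivrMl// -flow_costZ flow_psn_le.
apply/eqP; rewrite eq_le le/=.
have [->|k0] := eqVneq k 0.
  by rewrite normr0 powR0 ?gt_eqF// mul0r flow_psn_ge0.
have k0' : 0 < `|k| `^ p by rewrite powR_gt0// normr_gt0.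
rewrite -ler_pdivlMl//; have := le k^-1 (k *: v).
by rewrite scalerK// normfV -powR_inv1// -powRrM mulN1r powRN.
Qed.

(** Flows s for u and t for v add up to a flow for u + v, and the cost is subadditive edge by edge.
    The two infima are removed one after the other. *)
Lemma flow_psnD u v : flow_psn_val (u + v) <= flow_psn_val u + flow_psn_val v.
Proof.
rewrite -lerBlDl; apply: flow_psn_ge => t; rewrite lerBlDl -lerBlDr.
apply: flow_psn_ge => s; rewrite lerBlDr.
apply: le_trans (flow_psn_le _ (s + t)) _.
have e1 : (u + v).1 - (s + t) = (u.1 - s) + (v.1 - t).
  by rewrite opprD addrACA.
have e2 : (u + v).2 + (s + t) = (u.2 + s) + (v.2 + t) by rewrite addrACA.
rewrite /flow_cost e1 e2.
have := ler_wpM2r a0 (ler_normD_powR (u.1 - s) (v.1 - t) p0 p1).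
have := ler_wpM2r b0 (ler_normD_powR (u.2 + s) (v.2 + t) p0 p1).
have := ler_wpM2r c0 (ler_normD_powR s t p0 p1).
rewrite !mulrDl; lra.
Qed.

Definition flow_psn : pseminorm p (R^o * R^o)%type :=
  PSeminorm p0 flow_psn_ge0 flow_psnZ flow_psnD.

End StrictInequality.

Lemma powR2_lt2 {R : realType} (p : R) : p < 1 -> 2 `^ p < 2 :> R.
Proof.
move=> p1; rewrite -[ltRHS](@powRr1 R 2)// /powR gt_eqF//.
by rewrite ltr_expR ltr_pM2r// ln_gt0// ltr1n.
Qed.

(* The inequalities [|1-s|^p + |1+s|^p >= 2^p], [|1-s|^p + |s|^p >= 1] and
   [|1+s|^p + |s|^p >= 1] are never equalities simultaneously. *)
Lemma flow_gap_pos {R : realType} (p lo lx ly s : R) : 0 < p -> p < 1 ->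
  0 < lo -> 0 < lx -> 0 < ly -> 0 <= s ->
  2 `^ p * lo + lx + ly + Num.min (lo * (1 - 2 `^ p / 2)) ly / 2 <=
  `|1 - s| `^ p * (lo + lx) + `|1 + s| `^ p * (lo + ly) + `|s| `^ p * (lx + ly).
Proof.
move=> p0 p1 lo0 lx0 ly0 s0.
set e := Num.min _ _.
have e1 : e <= lo * (1 - 2 `^ p / 2) by rewrite ge_min lexx.
have e2 : e <= ly by rewrite ge_min lexx orbT.
have T2 := powR2_lt2 p1.
have e0 : 0 < e.
  by rewrite lt_min ly0 andbT mulr_gt0// subr_gt0 ltr_pdivrMr// mul1r.
have p1' := ltW p1.
have A : 2 `^ p <= `|1 - s| `^ p + `|1 + s| `^ p.
  have := ler_normD_powR (1 - s) (1 + s) p0 p1'.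
  by rewrite (_ : 1 - s + (1 + s) = 2) ?(ger0_norm (ler0n R 2))//; lra.
have B : 1 <= `|1 - s| `^ p + `|s| `^ p.
  by have := ler_normD_powR (1 - s) s p0 p1'; rewrite subrK normr1 powR1.
rewrite (ger0_norm s0) (@ger0_norm _ (1 + s)) ?addr_ge0// in A B *.
set X := `|1 - s| `^ p in A B *; set Y := (1 + s) `^ p in A *.
set Z := s `^ p in B *.
(* The difference of the two sides, regrouped by legs, has a third summand lx * (X + Z - 1),
   nonnegative by [B]. *)
suff : e / 2 <= lo * (X + Y - 2 `^ p) + ly * (Y + Z - 1).
  by have := ler_wpM2l (ltW lx0) B; lra.
have A' : 0 <= X + Y - 2 `^ p by rewrite subr_ge0.
(* For s <= 1 the two summands are at least (1 - s) * e and s * e; for s > 1 the second alone is at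
   least ly. *)
have [s1|s1] := leP s 1.
- have Z1 : s <= Z by apply: powR_ge_id; rewrite ?s0.
  have Y1 : 1 <= Y by apply: powR_ge1; lra.
  have YZ : s <= Y + Z - 1 by lra.
  have X1 : 1 - s <= X.
    by rewrite /X ger0_norm ?subr_ge0//; apply: powR_ge_id => //; lra.
  have Y2 : (1 + s) / 2 * 2 `^ p <= Y.
    rewrite /Y -{2}(divfK (_ : 2 != 0) (1 + s))// powRM ?divr_ge0 ?addr_ge0//.
    rewrite ler_wpM2r ?powR_ge0// powR_ge_id//; lra.
  have XY : (1 - s) * (1 - 2 `^ p / 2) <= X + Y - 2 `^ p by lra.
  have h1 := ler_wpM2l (ltW lo0) XY; have h2 := ler_wpM2l (ltW ly0) YZ.
  nra.
- have Y1 : 1 <= Y by apply: powR_ge1; lra.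
  have Z1 : 1 <= Z by apply: powR_ge1; lra.
  have := mulr_ge0 (ltW lo0) A'; have YZ : 1 <= Y + Z - 1 by lra.
  have := ler_wpM2l (ltW ly0) YZ; lra.
Qed.

(** The gap is uniform in s, so it survives the infimum. Negative s reduces to positive s by
    exchanging x and y, whence the minimum over both legs. *)
Lemma flow_gap {R : realType} (p lo lx ly : R) : 0 < p -> p < 1 ->
  0 < lo -> 0 < lx -> 0 < ly ->
  exists2 e, 0 < e & forall s,
    tripod_pow p lo lx ly 1 1 + e <=
    flow_cost p (lo + lx) (lo + ly) (lx + ly) (1, 1) s.
Proof.
move=> p0 p1 lo0 lx0 ly0; have T2 := powR2_lt2 p1.
pose m l := Num.min (lo * (1 - 2 `^ p / 2)) l / 2.
have m0 l : 0 < l -> 0 < m l.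
  move=> l0; rewrite divr_gt0// lt_min l0 andbT mulr_gt0// subr_gt0.
  by rewrite ltr_pdivrMr// mul1r.
exists (Num.min (m ly) (m lx)); first by rewrite lt_min !m0.
move=> s; rewrite /tripod_pow /flow_cost /= normr1 powR1 !mul1r ger0_norm//.
have [s0|s0] := leP 0 s.
  apply: le_trans (flow_gap_pos p0 p1 lo0 lx0 ly0 s0).
  by rewrite lerD2l ge_min lexx.
have s0' : 0 <= - s by lra.
have := flow_gap_pos p0 p1 lo0 ly0 lx0 s0'; rewrite /= opprK normrN.
have : Num.min (m ly) (m lx) <= m lx by rewrite ge_min lexx orbT.
rewrite /m; lra.
Qed.

(** * Amenability constants *)

Section Amenability.
Context {p : RR} {N M : Type} {dN : N -> N -> RR} {n0 : N}.
Context {dM : M -> M -> RR} {m0 : M} {j : N -> M}.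

Definition amen_bound (C : RR) := forall mu : seq (RR * N),
  (Fp_norm p dN n0 mu <= C%:E * Fp_norm p dM m0 [seq (q.1, j q.2) | q <- mu])%E.

Lemma amen_p_le C : 0 <= C -> amen_bound C ->
  (amen_p p dN n0 dM m0 j <= C%:E)%E.
Proof. by move=> C0 hC; apply: ereal_inf_lbound; exists C. Qed.

Lemma amen_p_ge k : (forall C, 0 <= C -> amen_bound C -> k <= C) ->
  (k%:E <= amen_p p dN n0 dM m0 j)%E.
Proof.
move=> h; apply: le_ereal_inf_tmp => _ [C [C0 [hC ->]]].
by rewrite lee_fin; exact: h.
Qed.

Lemma amen_bound_ge (mu : seq (RR * N)) (s t C : RR) : 0 <= C -> 0 < t ->
  (s%:E <= Fp_norm p dN n0 mu)%E ->
  (Fp_norm p dM m0 [seq (q.1, j q.2) | q <- mu] <= t%:E)%E ->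
  amen_bound C -> s / t <= C.
Proof.
move=> C0 t0 sN Mt hC; rewrite ler_pdivrMr// -lee_fin EFinM.
apply: le_trans sN (le_trans (hC mu) _).
by apply: lee_wpmul2l; rewrite ?lee_fin.
Qed.

End Amenability.

(* All the mass is routed through [z]. *)
Lemma Fp_norm_le_star (p : RR) (M T : Type) (dM : M -> M -> RR) (j : T -> M)
    (o x y : T) (z : M) (mu : seq (RR * T)) :
  0 < p -> o <> x -> o <> y -> x <> y ->
  (forall t, t = o \/ t = x \/ t = y) ->
  (Fp_norm p dM (j o) [seq (q.1, j q.2) | q <- mu] <=
   (tripod_pow p (dM z (j o) `^ p) (dM (j x) z `^ p) (dM (j y) z `^ p)
     (mass mu x) (mass mu y) `^ p^-1)%:E)%E.
Proof.
move=> p0 ox oy xy oxy; apply: Fp_norm_le => //.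
  by apply: tripod_pow_ge0; exact: powR_ge0.
move=> Y f [fo lf]; rewrite big_map /=.
rewrite (@sum_mass _ _ o x y (fun t => f (j t)))//.
move: (mass mu x) (mass mu y) => a b.
have [n_ge0 _ nZ nD] := pb_pnorm Y.
(* The contributions of [f z] cancel, and [f (j o)] is 0. *)
have -> : a *: f (j x) + b *: f (j y) = (a + b) *: (f z - f (j o)) +
    a *: (f (j x) - f z) + b *: (f (j y) - f z).
  rewrite fo subr0 !scalerBr scalerDl (addrC (a *: f z)).
  rewrite [X in _ = X + _]addrACA subrr addr0.
  by rewrite (addrC (b *: f z)) addrACA subrr addr0.
have term c u v r : pb_norm (f u - f v) <= r ->
    pb_norm (c *: (f u - f v)) `^ p <= `|c| `^ p * r `^ p.
  move=> fr; rewrite nZ powRM// ler_wpM2l ?powR_ge0// ge0_ler_powR ?(ltW p0)//.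
    by rewrite nnegrE.
  by rewrite nnegrE (le_trans _ fr).
apply: le_trans (nD _ _) _; apply: lerD; last exact: term.
by apply: le_trans (nD _ _) _; apply: lerD; exact: term.
Qed.

(** Lets the estimates for an embedding j be applied to N inside itself. *)
Lemma Fp_norm_map_id (p : RR) (T : Type) (d : T -> T -> RR) (o : T) mu :
  Fp_norm p d o [seq (q.1, id q.2) | q <- mu] = Fp_norm p d o mu.
Proof. by congr Fp_norm; rewrite -[RHS]map_id; apply: eq_map => -[]. Qed.

(** * Amenability constants in terms of the leg lengths *)

Section Tripod.
Context {p : RR} (p0 : 0 < p) (p1 : p < 1).
Context {T : Type} {d : T -> T -> RR} (hd : is_pmetric p d).
Context {o x y : T} (ox : o <> x) (oy : o <> y) (xy : x <> y).
Hypothesis oxy : forall t, t = o \/ t = x \/ t = y.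
Variable L : T -> RR.
Hypothesis L0 : forall u, 0 <= L u.
Hypothesis LE : forall u v, u <> v -> L u + L v = d u v `^ p.

Let S mu := tripod_pow p (L o) (L x) (L y) (mass mu x) (mass mu y).

Lemma S_le_Fp_norm (M : Type) (dM : M -> M -> RR) (j : T -> M) mu :
  is_pmetric p dM -> (forall u v, dM (j u) (j v) = d u v) ->
  ((S mu `^ p^-1)%:E <= Fp_norm p dM (j o) [seq (q.1, j q.2) | q <- mu])%E.
Proof.
by move=> hM jd; apply: tripod_le_Fp_norm => //; rewrite ?jd ?LE// ltW.
Qed.

Let Lox_gt0 : 0 < L o + L x.
Proof. by rewrite LE// (pmetric_gt0 hd). Qed.

(** The test element delta(x) has norm d(x,o) both in N and in M: S bounds it from below, the star
    centred at the base point from above. *)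
Lemma amen_p_ge1 (M : Type) (dM : M -> M -> RR) (j : T -> M) :
  is_pmetric p dM -> (forall u v, dM (j u) (j v) = d u v) ->
  (1%:E <= amen_p p d o dM (j o) j)%E.
Proof.
move=> hM jd; apply: amen_p_ge => C C0 hC.
pose mu : seq (RR * T) := [:: (1, x)].
have mx : mass mu x = 1 by rewrite /mass big_cons big_nil asboolT// addr0.
have my : mass mu y = 0 by rewrite /mass big_cons big_nil asboolF.
pose t := (L o + L x) `^ p^-1.
have t0 : 0 < t by rewrite powR_gt0.
have St : S mu `^ p^-1 = t.
  rewrite /S /tripod_pow mx my addr0 normr0 powR0 ?gt_eqF// mul0r addr0.
  by rewrite normr1 powR1 !mul1r.
rewrite -(divff (lt0r_neq0 t0)); apply: (amen_bound_ge C0 t0 _ _ hC (mu := mu)).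
  by rewrite -St -(Fp_norm_map_id p d) S_le_Fp_norm.
apply: le_trans (Fp_norm_le_star dM j (j o) mu p0 ox oy xy oxy) _.
rewrite mx my (pmetricxx hM) jd (pmetricC hd) -LE//.
rewrite /tripod_pow addr0 normr0 (@powR0 _ p) ?gt_eqF// mul0r mulr0 add0r addr0.
by rewrite normr1 powR1 mul1r.
Qed.

(** If the leg of u vanishes, then d(u,v)^p = L v for all v, so u is the centre. The star at u
    bounds the norm of N by the p-th root of S, which bounds that of M from below. *)
Lemma amen_p_le1 (M : Type) (dM : M -> M -> RR) (j : T -> M) u : L u = 0 ->
  is_pmetric p dM -> (forall u v, dM (j u) (j v) = d u v) ->
  (amen_p p d o dM (j o) j <= 1%:E)%E.
Proof.
move=> Lu hM jd; apply: amen_p_le => // mu; rewrite mul1e.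
apply: le_trans (S_le_Fp_norm mu hM jd).
rewrite -(Fp_norm_map_id p d).
apply: le_trans (Fp_norm_le_star d id u mu p0 ox oy xy oxy) _.
have du v : d u v `^ p = L v.
  have [<-|uv] := pselect (u = v); first by rewrite (pmetricxx hd).
  by rewrite -LE// Lu add0r.
by rewrite /= (pmetricC hd x) (pmetricC hd y) !du.
Qed.

Lemma aa_p_eq1 u : L u = 0 -> aa_p p d o = 1%:E.
Proof.
move=> Lu; apply/eqP; rewrite eq_le; apply/andP; split.
  apply: ge_ereal_sup => _ [M [dM [j [hM [_ [jd ->]]]]]].
  exact: amen_p_le1 Lu hM jd.
apply: le_trans (@amen_p_ge1 T d id hd _) _ => //.
by apply: ereal_sup_ubound; exists T, d, id; split=> //; split=> //.
Qed.

(** * The extension by a centre *)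

Section SteinerPoint.
Hypothesis L_gt0 : forall u, 0 < L u.
(** The new point is [None]. Prescribing only the values of d' covers both the metric given in the
    theorem and the one built in its proof. *)
Variable d' : option T -> option T -> RR.
Hypothesis dSS : forall u v, d' (Some u) (Some v) = d u v.
Hypothesis dNN : d' None None = 0.
Hypothesis dSN : forall u, d' (Some u) None = L u `^ p^-1.
Hypothesis dNS : forall u, d' None (Some u) = L u `^ p^-1.

Let dSNp u : d' (Some u) None `^ p = L u. Proof. by rewrite dSN powRVK. Qed.
Let dNSp u : d' None (Some u) `^ p = L u. Proof. by rewrite dNS powRVK. Qed.
Let dNNp : d' None None `^ p = 0. Proof. by rewrite dNN powR0 ?gt_eqF. Qed.

Lemma steiner_pmetric : is_pmetric p d'.
Proof.
case: (hd) => h1 h2 h3 h4; split.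
- by move=> [u|] [v|]; rewrite ?dSS ?dSN ?dNS ?dNN ?powR_ge0.
- move=> [u|] [v|]; rewrite ?dSS ?dSNp ?dNSp ?dNNp.
  + by rewrite h2; split=> [->|[]].
  + by split=> // Lu; have := L_gt0 u; rewrite Lu ltxx.
  + by split=> // Lu; have := L_gt0 v; rewrite Lu ltxx.
  + by split.
- by move=> [u|] [v|]; rewrite ?dSS ?dSNp ?dNSp ?dNNp.
- have le u v : d u v `^ p <= L u + L v.
    have [<-|uv] := pselect (u = v); last by rewrite LE.
    by rewrite (pmetricxx hd) addr_ge0.
  have ge u v : L u <= d u v `^ p + L v.
    have [<-|uv] := pselect (u = v); first by rewrite lerDr powR_ge0.
    by rewrite -LE// -addrA lerDl addr_ge0.
  move=> [u|] [v|] [w|]; rewrite ?dSS ?dSNp ?dNSp ?dNNp ?addr0 ?add0r//.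
  + by rewrite addrC (pmetricC hd).
  + by rewrite addr_ge0.
Qed.

Lemma steiner_Fp_norm_le mu :
  (Fp_norm p d' (Some o) [seq (q.1, Some q.2) | q <- mu] <= (S mu `^ p^-1)%:E)%E.
Proof.
apply: le_trans (Fp_norm_le_star d' Some None mu p0 ox oy xy oxy) _.
by rewrite !dSNp dNSp.
Qed.

(** Every constant admissible for the extension by the centre is admissible for M, since the norm
    there is at most the p-th root of S, hence at most the norm in M. *)
Lemma amen_p_le_steiner (M : Type) (dM : M -> M -> RR) (j : T -> M) :
  is_pmetric p dM -> (forall u v, dM (j u) (j v) = d u v) ->
  (amen_p p d o dM (j o) j <= amen_p p d o d' (Some o) Some)%E.
Proof.
move=> hM jd; apply: le_ereal_inf => _ [C [C0 [hC ->]]]; exists C; split=> //.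
split=> // mu; apply: le_trans (hC mu) _; apply: lee_wpmul2l; rewrite ?lee_fin//.
exact: le_trans (steiner_Fp_norm_le mu) (S_le_Fp_norm mu hM jd).
Qed.

Lemma amen_p_steiner_le_aa : (amen_p p d o d' (Some o) Some <= aa_p p d o)%E.
Proof.
apply: ereal_sup_ubound; exists (option T), d', Some; split.
  exact: steiner_pmetric.
by split=> [u v []|].
Qed.

Lemma aa_p_steiner : aa_p p d o = amen_p p d o d' (Some o) Some.
Proof.
apply/eqP; rewrite eq_le amen_p_steiner_le_aa andbT.
apply: ge_ereal_sup => _ [M [dM [j [hM [_ [jd ->]]]]]].
exact: amen_p_le_steiner.
Qed.

(** The test map sends o, x, y to 0, (1,0), (0,1) in the plane with the flow seminorm, where
    delta(x) + delta(y) becomes (1,1). *)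
Lemma Fp_norm_gap : exists2 e, 0 < e &
  (((tripod_pow p (L o) (L x) (L y) 1 1 + e) `^ p^-1)%:E <=
   Fp_norm p d o [:: (1%R, x); (1%R, y)])%E.
Proof.
have [e e0 he] := flow_gap p0 p1 (L_gt0 o) (L_gt0 x) (L_gt0 y).
exists e => //.
pose q := @flow_psn _ p p0 (ltW p1) _ _ _ (addr_ge0 (L0 o) (L0 x))
  (addr_ge0 (L0 o) (L0 y)) (addr_ge0 (L0 x) (L0 y)).
pose f (t : T) : RR^o * RR^o := ((`[< t = x >])%:R, (`[< t = y >])%:R).
have fo : f o = 0 by rewrite /f !asboolF.
have fx : f x = (1, 0) by rewrite /f asboolT// asboolF.
have fy : f y = (0, 1) by rewrite /f asboolF ?asboolT// => /esym.
have qle v s : q v <= flow_cost p (L o + L x) (L o + L y) (L x + L y) v s.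
  by apply: flow_psn_le; rewrite addr_ge0.
have zp : (0 : RR) `^ p = 0 by rewrite powR0 ?gt_eqF.
have qxo : q (f x - f o) <= d x o `^ p.
  rewrite fo subr0 fx; apply: le_trans (qle _ 0) _.
  rewrite /flow_cost /= subr0 addr0 normr0 zp normr1 powR1 mul1r !mul0r !addr0.
  by rewrite LE// (pmetricC hd).
have qyo : q (f y - f o) <= d y o `^ p.
  rewrite fo subr0 fy; apply: le_trans (qle _ 0) _.
  rewrite /flow_cost /= subr0 addr0 normr0 zp normr1 powR1 mul1r !mul0r addr0.
  by rewrite add0r LE// (pmetricC hd).
have qxy : q (f x - f y) <= d x y `^ p.
  (* The vector (1,-1) is carried entirely by the edge from x to y, hence s = 1; the edges to o used
     s = 0. *)
  rewrite fx fy; apply: le_trans (qle _ 1) _.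
  rewrite /flow_cost /= subr0 sub0r subrr addNr normr0 zp normr1 powR1 mul1r.
  by rewrite !mul0r !add0r LE.
have qf u v : q (f u - f v) <= d u v `^ p.
  have [->|uv] := pselect (u = v); first by rewrite subrr psn0 powR_ge0.
  by move: uv; case: (oxy u) => [->|[->|->]]; case: (oxy v) => [->|[->|->]] uv;
    first [by case: uv | by [] | by rewrite (psnB q) (pmetricC hd)].
have := Fp_norm_ge o [:: (1%R, x); (1%R, y)] (pmetric_ge0 hd) qf.
apply: le_trans; rewrite lee_fin ge0_ler_powR ?invr_ge0 ?(ltW p0)// ?nnegrE.
- by rewrite addr_ge0 ?tripod_pow_ge0// ltW.
- exact: psn_ge0.
- rewrite !big_cons big_nil /= addr0 !scale1r fo !subr0 fx fy.
  have -> : (1, 0) + (0, 1) = (1, 1) :> RR^o * RR^o.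
    by congr (_, _); rewrite /= ?addr0 ?add0r.
  exact: flow_psn_ge.
Qed.

(** At delta(x) + delta(y) the p-th power of the norm is at least S + e in N and at most S in the
    extension by the centre. *)
Lemma aa_p_gt1 : (1%:E < aa_p p d o)%E.
Proof.
apply: lt_le_trans amen_p_steiner_le_aa.
have [e e0 he] := Fp_norm_gap; set s := tripod_pow _ _ _ _ _ _ in he.
have s0 : 0 < s.
  by rewrite !addr_gt0// mulr_gt0 ?powR_gt0 ?normr_gt0 ?addr_gt0 ?gt_eqF.
have [m1 m2] : mass [:: (1%R, x); (1%R, y)] x = 1 /\
    mass [:: (1%R, x); (1%R, y)] y = 1.
  have yx : y <> x by move=> /esym.
  rewrite /mass !big_cons !big_nil /= (asboolF xy) (asboolF yx).
  by rewrite !asboolT// !addr0.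
have t0 : 0 < s `^ p^-1 by rewrite powR_gt0.
apply: (@lt_le_trans _ _ ((s + e) `^ p^-1 / s `^ p^-1)%:E).
  rewrite lte_fin ltr_pdivlMr// mul1r gt0_ltr_powR ?invr_gt0 ?nnegrE//.
  - exact: ltW.
  - by rewrite addr_ge0// ltW.
  - by rewrite ltrDl.
apply: amen_p_ge => C C0 hC; apply: (amen_bound_ge C0 t0 he _ hC).
by apply: le_trans (steiner_Fp_norm_le _) _; rewrite /S m1 m2.
Qed.

End SteinerPoint.

End Tripod.

(** * Gromov products and the conclusion *)

Lemma leg_lengths (p : RR) (T : Type) (d : T -> T -> RR) (o x y : T) :
  is_pmetric p d -> o <> x -> o <> y -> x <> y ->
  (forall t, t = o \/ t = x \/ t = y) ->
  exists L : T -> RR, [/\ forall u, 0 <= L u,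
    forall u v, u <> v -> L u + L v = d u v `^ p &
    (d x o `^ p + d y o `^ p = d x y `^ p \/
     d x o `^ p + d x y `^ p = d y o `^ p \/
     d y o `^ p + d x y `^ p = d x o `^ p) <-> exists u, L u = 0].
Proof.
move=> hd ox oy xy oxy.
have tri := pmetricD hd; have sym := pmetricC hd.
have t1 := tri o x y; have t2 := tri x o y; have t3 := tri y o x.
rewrite (sym o y) (sym o x) (sym y x) in t1 t2 t3.
set a := d x o `^ p in t1 t2 t3 *; set b := d y o `^ p in t1 t2 t3 *.
set c := d x y `^ p in t1 t2 t3 *.
(* The Gromov products solve the three linear equations. Each is half the slack of one triangle
   inequality, so it vanishes exactly at equality. *)
pose L u := if `[< u = o >] then (a + b - c) / 2
  else if `[< u = x >] then (a + c - b) / 2 else (b + c - a) / 2.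
have Lo : L o = (a + b - c) / 2 by rewrite /L asboolT.
have Lx : L x = (a + c - b) / 2.
  by rewrite /L asboolF ?asboolT// => /esym.
have Ly : L y = (b + c - a) / 2.
  by rewrite /L !asboolF// => /esym.
exists L; split.
- by move=> u; case: (oxy u) => [->|[->|->]]; rewrite ?Lo ?Lx ?Ly; lra.
- have eox : L o + L x = d o x `^ p by rewrite Lo Lx (sym o) -/a; lra.
  have eoy : L o + L y = d o y `^ p by rewrite Lo Ly (sym o) -/b; lra.
  have exy : L x + L y = d x y `^ p by rewrite Lx Ly -/c; lra.
  move=> u v; case: (oxy u) => [->|[->|->]]; case: (oxy v) => [->|[->|->]] uv;
    first [by case: uv | by [] | by rewrite addrC sym].
- split=> [[h|[h|h]]|[u]].
  + by exists o; rewrite Lo; lra.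
  + by exists x; rewrite Lx; lra.
  + by exists y; rewrite Ly; lra.
  case: (oxy u) => [->|[->|->]]; rewrite ?Lo ?Lx ?Ly => h;
    [left|right; left|right; right]; lra.
Qed.

Theorem theorem3p9 (p : RR) (hp0 : 0 < p) (hp1 : p < 1)
  (T : Type) (d : T -> T -> RR) (o x y : T)
  (hd : is_pmetric p d)
  (hox : o <> x) (hoy : o <> y) (hxy : x <> y)
  (hT : forall t : T, t = o \/ t = x \/ t = y) :
  ((d x o `^ p + d y o `^ p = d x y `^ p \/
    d x o `^ p + d x y `^ p = d y o `^ p \/
    d y o `^ p + d x y `^ p = d x o `^ p)
   <-> aa_p p d o = 1%:E) /\
  (aa_p p d o <> 1%:E ->
   forall d' : option T -> option T -> RR,
     (forall a b : T, d' (Some a) (Some b) = d a b) ->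
     d' None None = 0 ->
     (forall u1 u2 u3 : T, u1 <> u2 -> u1 <> u3 -> u2 <> u3 ->
        d' (Some u1) None =
          ((d u2 u1 `^ p + d u3 u1 `^ p - d u2 u3 `^ p) / 2) `^ (p^-1) /\
        d' None (Some u1) =
          ((d u2 u1 `^ p + d u3 u1 `^ p - d u2 u3 `^ p) / 2) `^ (p^-1)) ->
     is_pmetric p d' /\
     aa_p p d o = amen_p p d o d' (Some o) Some).
Proof.
have [L [L0 LE eqL]] := leg_lengths hd hox hoy hxy hT.
have aa1 : (d x o `^ p + d y o `^ p = d x y `^ p \/
    d x o `^ p + d x y `^ p = d y o `^ p \/
    d y o `^ p + d x y `^ p = d x o `^ p) -> aa_p p d o = 1%:E.
  by move=> /eqL[u Lu]; exact: (aa_p_eq1 hp0 hp1 hd hox hoy hxy hT L0 LE Lu).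
split; first (split=> // aa).
  apply/eqL; apply: contrapT => nL.
  have Lpos u : 0 < L u.
    rewrite lt_neqAle L0 andbT eq_sym; apply/eqP => Lu; apply: nL.
    by exists u.
  pose d' (s t : option T) : RR := match s, t with
    | Some u, Some v => d u v | None, None => 0
    | Some u, None | None, Some u => L u `^ p^-1 end.
  have := @aa_p_gt1 p hp0 hp1 T d hd o x y hox hoy hxy hT L L0 LE Lpos d'.
  (* The remaining premises of [h] are the values of [d'], true by computation. *)
  by rewrite aa ltxx => h; have : false by apply: h.
move=> naa d' dSS dNN dleg.
have Lpos u : 0 < L u.
  rewrite lt_neqAle L0 andbT eq_sym; apply/eqP => Lu; apply/naa/aa1/eqL.
  by exists u.
have dL u : d' (Some u) None = L u `^ p^-1 /\ d' None (Some u) = L u `^ p^-1.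
  (* Any enumeration of the other two points will do: by [LE] the prescribed quotient is ((L v + L
     u) + (L w + L u) - (L v + L w)) / 2 = L u. *)
  have [v [w [uv uw vw]]] : exists v w, [/\ u <> v, u <> w & v <> w].
    case: (hT u) => [->|[->|->]].
    - by exists x, y.
    - by exists o, y; split=> // /esym.
    - by exists o, x; split=> // /esym.
  have := dleg u v w uv uw vw.
  rewrite -(LE v u (nesym uv)) -(LE w u (nesym uw)) -(LE v w vw).
  by rewrite (_ : (_ / 2) = L u)//; lra.
have dSN u := (dL u).1; have dNS u := (dL u).2.
split; first exact: (steiner_pmetric hp0 hd L0 LE Lpos dSS dNN dSN dNS).
exact: (aa_p_steiner hp0 hp1 hd hox hoy hxy hT L0 LE Lpos dSS dNN dSN dNS).
Qed.
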